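(* Let $k\geq 2$ and $b\geq 2$ be integers and let $\mathbf{a}=(a_n)_{n\geq 0}$ be a $k$-automatic sequence with values in $\{0,1,\dots,b-1\}$. Write $\mathbf{a}=\varphi(\sigma^\infty(i))$, where $\sigma$ is a $k$-uniform morphism on a finite alphabet $\mathcal{I}$, $i\in\mathcal{I}$ is a letter such that $\sigma(i)$ begins with $i$, and $\varphi:\mathcal{I}\to\{0,\dots,b-1\}$ is a coding. Let $d$ be the cardinality of $\mathcal{I}$ and let $m$ be the cardinality of the $k$-kernel of $\mathbf{a}$. Then the irrationality measure of $\xi=\sum_{n=0}^{+\infty}a_n/b^n$ satisfies $\mu(\xi)\leq dk(k^m+1)$.
   Context: A sequence is $k$-automatic iff it is the image under a coding of a fixed point of a $k$-uniform morphism (Cobham), so a representation as in the claim exists. A morphism $\sigma$ of the free monoid $\mathcal{I}^*$ is $k$-uniform if $|\sigma(c)|=k$ for every letter $c$; a coding is a letter-to-letter morphism; $\sigma^\infty(i)$ denotes the infinite word $\lim_n\sigma^n(i)$, a fixed point of $\sigma$. The set $\mathcal{I}$ is called the internal alphabet. The $k$-kernel of $(a_n)_{n\geq0}$ is the set of all sequences $(a_{k^e n+j})_{n\geq 0}$ with $e\geq 0$ and $0\leq j<k^e$. The irrationality measure $\mu(\xi)$ is the supremum of the real $\tau>0$ for which $|\xi-p/q|<q^{-\tau}$ has infinitely many solutions with $p,q$ coprime integers. *)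

(* Defs.v *)
From HB Require Import structures.
From mathcomp Require Import all_boot all_order all_algebra.
From mathcomp Require Import finmap.
From mathcomp Require Import all_classical all_reals all_analysis.
Import Order.TTheory GRing.Theory Num.Theory.
Import numFieldNormedType.Exports.

Set Implicit Arguments.
Unset Strict Implicit.
Unset Printing Implicit Defensive.

Local Open Scope nat_scope.
Local Open Scope classical_set_scope.

(* A morphism of the free monoid on [A] is given by the images of the letters;
   [morph_ext s] is its action on words. *)
Definition morph_ext (A : Type) (s : A -> seq A) (w : seq A) : seq A :=
  flatten (map s w).

Definition uniform_morph (k : nat) (A : Type) (s : A -> seq A) : Prop :=
  forall c, size (s c) = k.

(* The n-th letter of lim_N s^N(i), read off s^n(i).  When [s] is k-uniform with
   k >= 2 and [s i] begins with [i], s^n(i) has length k ^ n > n and is a prefix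
   of every later iterate (see [morph_limitE]), so the default value of [nth] is
   never used. *)
Definition morph_limit (A : Type) (s : A -> seq A) (i : A) (n : nat) : A :=
  nth i (iter n (morph_ext s) [:: i]) n.

Section MorphLimit.
Variables (A : eqType) (k : nat) (s : A -> seq A) (i : A).
Hypotheses (k_ge2 : 2 <= k) (s_unif : uniform_morph k s).
Hypothesis (s_i : ohead (s i) = Some i).

Lemma size_iter_morph n : size (iter n (morph_ext s) [:: i]) = k ^ n.
Proof.
elim: n => //= n IHn; rewrite expnS -IHn /morph_ext size_flatten
  /shape -map_comp.
elim: (iter _ _ _) => [|c w IHw] /=; first by rewrite muln0.
by rewrite IHw s_unif mulnS.
Qed.

Lemma prefix_iter_morph n p :
  prefix (iter n (morph_ext s) [:: i]) (iter (n + p) (morph_ext s) [:: i]).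
Proof.
elim: n => [|n /prefixP[t ht]] /=; last first.
  by rewrite ht /morph_ext map_cat flatten_cat prefix_prefix.
elim: p => [|p]; first by rewrite prefix_refl.
rewrite !add0n => /prefixP[t ht]; rewrite iterS ht /morph_ext /=.
by case: (s i) s_i => //= c w [->]; rewrite eqxx prefix0s.
Qed.

Lemma morph_limitE N n :
  n < k ^ N -> nth i (iter N (morph_ext s) [:: i]) n = morph_limit s i n.
Proof.
have stable p q : n < k ^ p -> nth i (iter (p + q) (morph_ext s) [:: i]) n =
    nth i (iter p (morph_ext s) [:: i]) n.
  move=> np; have /prefixP[t ->] := prefix_iter_morph p q.
  by rewrite nth_cat size_iter_morph np.
move=> nN; have nn : n < k ^ n by exact: ltn_expl.
by rewrite /morph_limit -(stable n N nn) addnC; apply/esym/stable.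
Qed.

End MorphLimit.

Definition base_value (k : nat) (w : seq 'I_k) : nat :=
  foldl (fun n (c : 'I_k) => n * k + c) 0 w.

Definition no_leading_zero (k : nat) (w : seq 'I_k) : bool :=
  if w is c :: _ then nat_of_ord c != 0 else true.

(* Finite automaton with output, reading the canonical base-k expansion of n
   from the most significant digit; the expansion of 0 is the empty word. *)
Definition automatic (k : nat) (T : Type) (a : nat -> T) : Prop :=
  exists (Q : finType) (q0 : Q) (delta : Q -> 'I_k -> Q) (out : Q -> T),
    forall w : seq 'I_k, no_leading_zero w ->
      a (base_value w) = out (foldl delta q0 w).

Definition k_kernel (k : nat) (T : Type) (a : nat -> T) : set (nat -> T) :=
  [set s | exists e j, j < k ^ e /\ s = (fun n => a (k ^ e * n + j))].

Local Open Scope ring_scope.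

Definition approximations (R : realType) (xi tau : R) : set (int * int) :=
  [set pq | 0 < pq.2 /\ coprimez pq.1 pq.2 /\
    `| xi - pq.1%:~R / pq.2%:~R | < pq.2%:~R `^ (- tau)].

(* Valued in the extended reals, so that Liouville numbers have measure +oo. *)
Definition irrationality_measure (R : realType) (xi : R) : \bar R :=
  ereal_sup [set tau%:E | tau in
    [set tau : R | 0 < tau /\ infinite_set (approximations xi tau)]].

(* Main.v *)
(* Two of the first d + 1 letters of sigma^oo(i) agree, say at positions
   r0 < t0 <= d. Applying sigma^n, the sequence a agrees up to index
   t0 k^n + k^n with the word U V V V ..., where |U| = r0 k^n and |UV| = t0 k^n.
   The value of that word is a fraction P_n / Q_n with Q_n <= b^(t0 k^n), so
   |xi - P_n / Q_n| is at most of order b^(-(t0 + 1) k^n).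
   Conversely, if a agrees with U V V V ... up to index k^m |UV| then it does so
   forever, and xi is rational; otherwise |xi - P_n / Q_n| is at least
   b^(-(k^m + 1) t0 k^n). As the exponents t0 k^n grow only by a factor k
   at each step, these two estimates bound the distance from xi to every fraction. *)

Require Import Defs.
From HB Require Import structures.
From mathcomp Require Import all_boot all_order all_algebra.
From mathcomp Require Import finmap.
From mathcomp Require Import all_classical all_reals all_analysis.
From mathcomp Require Import zify ring lra.
Import Order.TTheory GRing.Theory Num.Theory.
Import numFieldNormedType.Exports.
Local Open Scope classical_set_scope.
Local Open Scope nat_scope.

(** * Letters of the fixed point of a uniform morphism *)

Lemma nth_flatten_uniform (A : Type) (x0 : A) (k : nat) (ss : seq (seq A)) n j :
  all (fun s => size s == k) ss -> j < k -> n < size ss ->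
  nth x0 (flatten ss) (k * n + j) = nth x0 (nth [::] ss n) j.
Proof.
move=> + jk; elim: ss n => //= s ss IH [|n] /andP[/eqP sk ssk] nss.
  by rewrite muln0 add0n nth_cat sk jk.
rewrite nth_cat sk ltnNge mulnS -addnA leq_addr /= addKn; exact: IH.
Qed.

Lemma morph_limit_step (A : eqType) (k : nat) (s : A -> seq A) (i : A) n j :
  2 <= k -> uniform_morph k s -> ohead (s i) = Some i -> j < k ->
  morph_limit s i (k * n + j) = nth i (s (morph_limit s i n)) j.
Proof.
move=> k2 sk si jk; have nn : n < k ^ n by exact: ltn_expl.
have sz := @size_iter_morph A k s i sk n.
rewrite -(@morph_limitE A k s i k2 sk si n.+1); last first.
  by rewrite expnS; apply: (@leq_trans (k * n.+1)); rewrite ?leq_mul2l ?nn ?orbT//; lia.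
rewrite iterS /morph_ext nth_flatten_uniform ?size_map ?sz//; last first.
  by apply/allP => _ /mapP[c _ ->]; rewrite sk.
by rewrite (nth_map i) ?sz.
Qed.

(** The map [h] sends [c] to the letter of index [j] in [s^e(c)]. That it does not depend on [n]
    yields both the finiteness of the kernel and the repetition of whole blocks of length
    [k ^ e]. *)
Lemma morph_limit_pow (A : eqType) (k : nat) (s : A -> seq A) (i : A) e j :
  2 <= k -> uniform_morph k s -> ohead (s i) = Some i -> j < k ^ e ->
  exists h : A -> A, forall n,
    morph_limit s i (k ^ e * n + j) = h (morph_limit s i n).
Proof.
move=> k2 sk si; have k0 : 0 < k by lia.
elim: e j => [|e IHe] j.
  by rewrite ltnS leqn0 => /eqP ->; exists id => n; rewrite mul1n addn0.
rewrite expnS mulnC -ltn_divLR// => /IHe[h hE].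
exists (fun c => nth i (s (h c)) (j %% k)) => n.
rewrite -hE -(@morph_limit_step A k) ?ltn_pmod//; congr morph_limit.
by rewrite {1}(divn_eq j k); nia.
Qed.

(** * The [k]-kernel and the propagation of periods *)

Lemma finite_k_kernel (k : nat) (T : Type) (a : nat -> T) (I : finType)
    (s : I -> seq I) (i : I) (phi : I -> T) :
  2 <= k -> uniform_morph k s -> ohead (s i) = Some i ->
  (forall n, a n = phi (morph_limit s i n)) -> finite_set (k_kernel k a).
Proof.
move=> k2 sk si aE.
(* Each kernel element has this form for some self-map [h] of the finite alphabet. *)
pose F (h : {ffun I -> I}) n := phi (h (morph_limit s i n)).
apply: (@sub_finite_set _ _ (F @` setT)); last exact/finite_image/finite_finset.
move=> _ [e [j [je ->]]]; have [h hE] := morph_limit_pow _ _ _ i e j k2 sk si je.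
exists [ffun c => h c] => //; apply/funext => n.
by rewrite /F ffunE aE hE.
Qed.

(** The [e'] lowest digits of [j] lead to an intermediate kernel element, from which the remaining
    digits are read. *)
Lemma kernel_split (k : nat) (T : Type) (a : nat -> T) e e' j n :
  0 < k -> e' <= e ->
  a (k ^ e * n + j) =
  a (k ^ e' * (k ^ (e - e') * n + j %/ k ^ e') + j %% k ^ e').
Proof.
move=> k0 ee; congr a; rewrite {1}(divn_eq j (k ^ e')) -{1}(subnKC ee) expnD.
by nia.
Qed.

(* View kernel elements as states, [x] being reached along the digits of [j]: a
   path at least as long as the number of states visits one twice, hence can be
   shortened. *)
Lemma k_kernel_depth (k : nat) (T : choiceType) (a : nat -> T) (x : nat -> T) :
  0 < k -> finite_set (k_kernel k a) -> k_kernel k a x ->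
  exists e j, [/\ e < #|` fset_set (k_kernel k a)|%fset, j < k ^ e &
    x = fun n => a (k ^ e * n + j)].
Proof.
move=> k0 fin [e]; set m := #|` _|%fset.
elim/ltn_ind: e x => e IHe x [j [je xE]].
have [em|me] := ltnP e m; first by exists e, j.
(* State after the [l] lowest digits of [j]. There are [e + 1 > m] choices of [l], so two of them
   give the same state. *)
pose st (l : 'I_e.+1) : nat -> T := fun n => a (k ^ l * n + j %% k ^ l).
have stK l : st l \in fset_set (k_kernel k a).
  rewrite in_fset_set// inE; exists l, (j %% k ^ l); split => //.
  by rewrite ltn_pmod// expn_gt0 k0.
have /injectivePn[l [l' ne eq]] : ~~ injectiveb st.
  apply/negP => stu.
  have := @uniq_leq_size _ _ (fset_set (k_kernel k a)) stu.
  rewrite size_map -cardE card_ord => H; suff : e < m by lia.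
  by apply: H => _ /codomP[l ->]; exact: stK.
wlog ll : l l' ne eq / l < l'.
  move=> W; case: (ltngtP l l') => [h|h|/val_inj h]; last by rewrite h eqxx in ne.
  - exact: (W l l').
  - by apply: (W l' l) => //; rewrite eq_sym.
apply: (IHe (l + (e - l'))); first by have := ltn_ord l'; lia.
have l'e : l' <= e by have := ltn_ord l'; lia.
(* The digits of [j] in positions [l] to [l' - 1] are cut out. *)
exists (k ^ l * (j %/ k ^ l') + j %% k ^ l); split.
  have jl : j %/ k ^ l' < k ^ (e - l').
    by rewrite ltn_divLR ?expn_gt0 ?k0// -expnD subnK.
  have := ltn_pmod j (_ : 0 < k ^ l); rewrite expn_gt0 k0 => /(_ isT).
  by rewrite expnD; nia.
rewrite xE; apply/funext => n; rewrite (kernel_split k _ a e l')//.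
have /(congr1 (fun f => f (k ^ (e - l') * n + j %/ k ^ l'))) := eq.
rewrite /st => <-; congr a; rewrite expnD; nia.
Qed.

Lemma modn_subl_period r s n k : r + s * k <= n ->
  (n - s * k - r) %% s = (n - r) %% s.
Proof.
rewrite mulnC => h; have -> : n - r = k * s + (n - k * s - r) by lia.
by rewrite modnMDl.
Qed.

(* Put L = k (r + s). By [k_kernel_depth], all kernel elements x agree
   with an s-periodic sequence on [r, L); as x (k n + j) is the n-th term of
   another kernel element, x is ks-periodic from kr on, and s divides ks, so the
   period s propagates beyond L. *)
Lemma periodic_of_periodic_prefix (k : nat) (T : choiceType) (a : nat -> T) r s :
  2 <= k -> finite_set (k_kernel k a) -> 0 < s ->
  (forall n, r <= n < k ^ #|` fset_set (k_kernel k a)|%fset * (r + s) ->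
    a n = a (r + (n - r) %% s)) ->
  forall n, r <= n -> a n = a (r + (n - r) %% s).
Proof.
move=> k2 fin s0; set m := #|` _|%fset => H; have k0 : 0 < k by lia.
have base n n' : r <= n < k ^ m * (r + s) -> r <= n' < k ^ m * (r + s) ->
    n = n' %[mod s] -> a n = a n'.
  move=> h h' nn; rewrite (H _ h) (H _ h'); congr (a (r + _)); apply/eqP.
  rewrite -(eqn_modDr r) !subnK; lia.
suff main x : k_kernel k a x -> forall n, r <= n -> x n = x (r + (n - r) %% s).
  apply: main; exists 0, 0; split => //; apply/funext => n.
  by rewrite mul1n addn0.
move=> + n; elim/ltn_ind: n x => n IHn x Kx rn.
have [nL|Ln] := ltnP n (k * (r + s)).
  have [e [j [em je ->]]] := k_kernel_depth _ _ _ _ k0 fin Kx.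
  have bound n' : r <= n' < k * (r + s) ->
      r <= k ^ e * n' + j < k ^ m * (r + s).
    move=> /andP[rn' nL']; have K0 : 0 < k ^ e by rewrite expn_gt0 k0.
    (* The strict inequality [e < m] leaves room for the factor [k] in the bound on [n']. *)
    have : k ^ e.+1 <= k ^ m by rewrite leq_exp2l.
    rewrite expnS => km; apply/andP; split; first by nia.
    apply: (@leq_trans (k ^ e * k * (r + s))); first by nia.
    by rewrite leq_mul2r mulnC km orbT.
  have ms := ltn_pmod (n - r) s0.
  apply: base; [apply: bound; lia | apply: bound; nia |].
  apply/eqP; rewrite eqn_modDr -modnMmr -[X in _ == X]modnMmr; apply/eqP.
  by rewrite modnDmr subnKC.
have [K' KE] : exists y, k_kernel k a y /\ forall n', y n' = x (k * n' + n %% k).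
  have [e [j [je xE]]] := Kx.
  exists (fun n' => a (k ^ e.+1 * n' + (k ^ e * (n %% k) + j))); split.
    exists e.+1, (k ^ e * (n %% k) + j); split => //; rewrite expnS.
    by have := ltn_pmod n k0; nia.
  by move=> n'; rewrite xE expnS; congr a; nia.
case: KE => Ky yE; set q := n %/ k.
have nE : n = k * q + n %% k by rewrite mulnC -divn_eq.
(* Hence [q - s] is still at least [r], and the induction hypothesis applies to [y] at both [q] and
   [q - s]. *)
have qL : r + s <= q by rewrite leq_divRL// mulnC.
have qn : q < n by apply: ltn_Pdiv; lia.
have step : x n = x (n - s * k).
  rewrite {1}nE -yE (IHn q)//; last by lia.
  have -> : n - s * k = k * (q - s) + n %% k by rewrite {1}nE; nia.
  rewrite -yE (IHn (q - s))//; [|lia..].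
  by rewrite -(modn_subl_period r s q 1) ?muln1.
have sk : r + s * k <= n by nia.
rewrite step (IHn (n - s * k))//; [| |lia].
  by rewrite modn_subl_period.
have : 0 < s * k by rewrite muln_gt0 s0.
by lia.
Qed.

Local Open Scope ring_scope.

(** * Reals given by base [b] digit sequences *)

Definition digit_term (R : realType) (b : nat) (f : nat -> nat) (n : nat) : R :=
  (f n)%:R / b%:R ^+ n.

Definition digit_value (R : realType) (b : nat) (f : nat -> nat) : R :=
  limn (series (digit_term R b f)).

Lemma digit_term_ge0 (R : realType) b f n : 0 <= digit_term R b f n.
Proof. by rewrite divr_ge0 ?exprn_ge0. Qed.

Lemma partial_value_homo (R : realType) b f :
  {homo series (digit_term R b f) : n m / (n <= m)%N >-> n <= m}.
Proof.
apply: homo_leq => [//|?|n]; first exact: le_trans.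
by rewrite seriesSr lerDl digit_term_ge0.
Qed.

(** The right-hand side is the sum of [(b - 1) / b ^ i] for [i < n]. The digit of index 0 is the
    units digit, so values range up to [b], not 1. *)
Lemma partial_value_le (R : realType) b f n : (0 < b)%N ->
  (forall n, f n < b)%N ->
  series (digit_term R b f) n <= b%:R - b%:R / b%:R ^+ n.
Proof.
move=> b0 fb; have bR : 0 < b%:R :> R by rewrite ltr0n.
elim: n => [|n IHn]; first by rewrite seriesEnat /= big_geq// expr0 divr1 subrr.
rewrite seriesSr.
apply: (le_trans (lerD IHn (_ : _ <= (b%:R - 1) / b%:R ^+ n))).
  rewrite ler_pM2r ?invr_gt0 ?exprn_gt0// -(@natrB _ _ 1)// ler_nat.
  by have := fb n; lia.
rewrite exprS invfM mulrA divff ?gt_eqF//; lra.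
Qed.

Lemma is_cvg_partial_value (R : realType) b f : (0 < b)%N ->
  (forall n, f n < b)%N -> cvgn (series (digit_term R b f)).
Proof.
move=> b0 fb; apply: nondecreasing_is_cvgn; first exact: partial_value_homo.
exists b%:R => _ [n _ <-]; apply: (le_trans (partial_value_le R b f n b0 fb)).
by rewrite gerBl divr_ge0 ?exprn_ge0.
Qed.

Lemma digit_value_ge0 (R : realType) b f : (0 < b)%N ->
  (forall n, f n < b)%N -> 0 <= digit_value R b f.
Proof.
move=> b0 fb; apply: limr_ge; first exact: is_cvg_partial_value.
by apply: nearW => n; apply: sumr_ge0 => *; exact: digit_term_ge0.
Qed.

Lemma digit_value_leb (R : realType) b f : (0 < b)%N ->
  (forall n, f n < b)%N -> digit_value R b f <= b%:R.
Proof.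
move=> b0 fb; apply: limr_le; first exact: is_cvg_partial_value.
apply: nearW => n; apply: (le_trans (partial_value_le R b f n b0 fb)).
by rewrite gerBl divr_ge0 ?exprn_ge0.
Qed.

Lemma digit_value_shift (R : realType) b f N : (0 < b)%N ->
  (forall n, f n < b)%N ->
  digit_value R b f = series (digit_term R b f) N +
    digit_value R b (fun n => f (n + N)%N) / b%:R ^+ N.
Proof.
move=> b0 fb; set g := fun n => _; have gb n : (g n < b)%N by exact: fb.
apply: cvg_lim => //; rewrite -(cvg_shiftn N).
have -> : [sequence series (digit_term R b f) (n + N)%N]_n =
    (fun n => series (digit_term R b f) N +
              series (digit_term R b g) n / b%:R ^+ N).
  apply/funext => n /=; elim: n => [|n IHn].
    by rewrite add0n [series (digit_term R b g) 0]big_geq// mul0r addr0.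
  rewrite addSn !seriesSr IHn mulrDl addrA; congr (_ + _).
  by rewrite /digit_term exprD invfM mulrA.
apply: cvgD; first exact: cvg_cst.
by apply: cvgMl; exact: is_cvg_partial_value.
Qed.

Lemma digit_value_lead (R : realType) b f : (0 < b)%N ->
  (forall n, f n < b)%N ->
  digit_value R b f = (f 0%N)%:R + digit_value R b (fun n => f n.+1) / b%:R.
Proof.
move=> b0 fb; rewrite (digit_value_shift R b f 1)// seriesEnat /= big_nat1.
rewrite /digit_term expr0 divr1 expr1; congr (_ + digit_value _ _ _ / _).
by apply/funext => n; rewrite addn1.
Qed.

Lemma digit_value_gt0 (R : realType) b f j : (0 < b)%N ->
  (forall n, f n < b)%N -> (0 < f j)%N -> 0 < digit_value R b f.
Proof.
move=> b0; elim: j f => [|j IHj] f fb fj; rewrite digit_value_lead//.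
  by rewrite ltr_pwDl ?ltr0n// divr_ge0// digit_value_ge0.
by rewrite ltr_wpDl// divr_gt0 ?ltr0n//; exact: IHj.
Qed.

(** Only the constant sequence [b - 1] attains [b]. Induction on [j] brings the smaller digit to the
    front. *)
Lemma digit_value_ltb (R : realType) b f j : (0 < b)%N ->
  (forall n, f n < b)%N -> (f j < b.-1)%N -> digit_value R b f < b%:R.
Proof.
move=> b0; have bR : 0 < b%:R :> R by rewrite ltr0n.
elim: j f => [|j IHj] f fb fj; rewrite digit_value_lead//.
  have : digit_value R b (fun n => f n.+1) / b%:R <= 1.
    by rewrite ler_pdivrMr// mul1r digit_value_leb.
  have : (f 0%N).+2%:R <= b%:R :> R by rewrite ler_nat; lia.
  rewrite -!natr1; lra.
have : digit_value R b (fun n => f n.+1) / b%:R < 1.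
  by rewrite ltr_pdivrMr// mul1r; exact: IHj.
have : (f 0%N).+1%:R <= b%:R :> R by rewrite ler_nat.
rewrite -!natr1; lra.
Qed.

Lemma partial_value_nat (R : realType) b f N : (0 < b)%N ->
  exists A : nat, series (digit_term R b f) N.+1 = A%:R / b%:R ^+ N.
Proof.
move=> b0; have bR : b%:R != 0 :> R by rewrite pnatr_eq0; lia.
elim: N => [|N [A IHN]].
  exists (f 0%N); rewrite seriesEnat /= big_nat1.
  by rewrite /digit_term expr0.
exists (A * b + f N.+1)%N; rewrite seriesSr.
rewrite IHN /digit_term natrD natrM mulrDl; congr (_ + _).
by rewrite exprSr invfM mulrA [A%:R * _ / _]mulrAC mulfK.
Qed.

Lemma partial_value_eq (R : realType) b f g N :
  (forall n, n < N -> f n = g n)%N ->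
  series (digit_term R b f) N = series (digit_term R b g) N.
Proof.
move=> fg; rewrite !seriesEnat /=.
by apply: eq_big_nat => i /andP[_ iN]; rewrite /digit_term fg.
Qed.

(** The first [N] terms cancel, and both tails are values in [[0, b]] divided by [b ^ N]. *)
Lemma digit_value_dist_le (R : realType) b f g N : (0 < b)%N ->
  (forall n, f n < b)%N -> (forall n, g n < b)%N ->
  (forall n, n < N -> f n = g n)%N ->
  `|digit_value R b f - digit_value R b g| <= b%:R / b%:R ^+ N.
Proof.
move=> b0 fb gb fg; rewrite (digit_value_shift R b f N)//.
rewrite (digit_value_shift R b g N)// (partial_value_eq R b f g N fg).
rewrite opprD addrACA subrr add0r -mulrBl normrM.
rewrite (ger0_norm (_ : 0 <= (b%:R ^+ N)^-1)) ?invr_ge0 ?exprn_ge0//.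
rewrite ler_pM2r ?invr_gt0 ?exprn_gt0 ?ltr0n//.
have fge := digit_value_ge0 R b (fun n => f (n + N)%N) b0 (fun n => fb _).
have gge := digit_value_ge0 R b (fun n => g (n + N)%N) b0 (fun n => gb _).
have fle := digit_value_leb R b (fun n => f (n + N)%N) b0 (fun n => fb _).
have gle := digit_value_leb R b (fun n => g (n + N)%N) b0 (fun n => gb _).
by rewrite ler_norml; apply/andP; split; lra.
Qed.

(** * Lower bounds for distances to fractions *)

Lemma fraction_dist_ge (R : realFieldType) (p q p' q' : int) :
  0 < q -> 0 < q' -> p%:~R / q%:~R != p'%:~R / q'%:~R :> R ->
  (q%:~R * q'%:~R)^-1 <= `|p%:~R / q%:~R - p'%:~R / q'%:~R| :> R.
Proof.
move=> q0 q'0; have qR : 0 < q%:~R :> R by rewrite ltr0z.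
have qR' : 0 < q'%:~R :> R by rewrite ltr0z.
have qq : 0 < (q%:~R * q'%:~R)^-1 :> R by rewrite invr_gt0 mulr_gt0.
have diffE : p%:~R / q%:~R - p'%:~R / q'%:~R =
    (p * q' - p' * q)%:~R / (q%:~R * q'%:~R) :> R.
  by rewrite intrB !intrM; field; rewrite !gt_eqF.
rewrite -subr_eq0 diffE => ne.
rewrite normrM (gtr0_norm qq) ler_peMl ?(ltW qq)//.
rewrite -intr_norm -[1]/(1%:~R) ler_int -gtz0_ge1 normr_gt0.
by apply: contra ne => /eqP ->; rewrite mul0r.
Qed.

(* If [f N > g N] then [A / b ^ N] separates the two values, where [A / b ^ N]
   is the truncation of [f]; the separation from [g] is strict since [g] does not
   end in digits [b - 1] only. If [f N < g N], use [(A + 1) / b ^ N]. *)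
Lemma digit_value_dist_ge (R : realType) b f g N j (p q : int) : (0 < b)%N ->
  (forall n, f n < b)%N -> (forall n, g n < b)%N ->
  (forall n, n < N -> f n = g n)%N -> f N != g N ->
  (N < j)%N -> g j = g N -> 0 < q ->
  digit_value R b g = p%:~R / q%:~R ->
  (b%:R ^+ N * q%:~R)^-1 <= `|digit_value R b f - digit_value R b g|.
Proof.
move=> b0 fb gb fg fgN Nj gj q0 gE; have bR : 0 < b%:R :> R by rewrite ltr0n.
have BR : 0 < b%:R ^+ N :> R by rewrite exprn_gt0.
have [A AE] := partial_value_nat R b f N b0.
have fE := digit_value_shift R b f N.+1 b0 fb.
have gE' := digit_value_shift R b g N.+1 b0 gb.
rewrite seriesSr -(partial_value_eq R b f g N fg) in gE'.
have AE' : series (digit_term R b f) N = (A%:R - (f N)%:R) / b%:R ^+ N.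
  by apply/eqP; rewrite mulrBl eq_sym subr_eq -AE seriesSr.
rewrite AE' in gE'; rewrite AE in fE.
move: fE gE'; set f2 := fun n => f _; set g2 := fun n => g _ => fE gE'.
have f2ge := digit_value_ge0 R b f2 b0 (fun n => fb _).
have f2le := digit_value_leb R b f2 b0 (fun n => fb _).
have g2ge := digit_value_ge0 R b g2 b0 (fun n => gb _).
have g2le := digit_value_leb R b g2 b0 (fun n => gb _).
(* This later digit is positive if [f N < g N] and below [b - 1] if [g N < f N], which keeps the
   tail of [g] off the relevant extreme, 0 or [b]. *)
have g2j : g2 (j - N.+1)%N = g N by rewrite /g2 subnK.
have fE1 : digit_value R b f = (A%:R + digit_value R b f2 / b%:R) / b%:R ^+ N.
  by rewrite fE exprS invfM mulrDl mulrA.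
have gE1 : digit_value R b g =
    (A%:R - (f N)%:R + (g N)%:R + digit_value R b g2 / b%:R) / b%:R ^+ N.
  by rewrite gE' /digit_term exprS invfM !mulrDl mulrA.
(* It suffices to find [Z / b ^ N] between the two values and distinct from [p / q]: it is at least
   [1 / (b ^ N q)] away from [p / q], and the value of [f] is no closer. *)
have sep (Z : int) : 
    digit_value R b g < Z%:~R / b%:R ^+ N <= digit_value R b f \/
    digit_value R b f <= Z%:~R / b%:R ^+ N < digit_value R b g ->
  (b%:R ^+ N * q%:~R)^-1 <= `|digit_value R b f - digit_value R b g|.
  have Bq : (b%:R ^+ N : R) = ((b ^ N)%N : int)%:~R by rewrite -natrX.
  have Bq0 : 0 < ((b ^ N)%N : int) by rewrite ltz_nat expn_gt0 b0.
  have D := fraction_dist_ge R Z ((b ^ N)%N : int) p q Bq0 q0.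
  rewrite -gE -Bq in D => -[]/andP[h1 h2].
    apply: (le_trans (D _)); first by rewrite gt_eqF.
    by rewrite !gtr0_norm ?subr_gt0//; [lra|exact: lt_le_trans h2].
  apply: (le_trans (D _)); first by rewrite lt_eqF.
  by rewrite !ltr0_norm ?subr_lt0//; [lra|exact: le_lt_trans h2].
have [fgN'|gfN|/eqP] := ltngtP (f N) (g N); last by rewrite (negbTE fgN).
- have g2gt : 0 < digit_value R b g2 / b%:R.
    rewrite divr_gt0//; apply: (digit_value_gt0 R b g2 (j - N.+1) b0 (fun n => gb _)).
    by rewrite g2j; lia.
  have f2le1 : digit_value R b f2 / b%:R <= 1 by rewrite ler_pdivrMr// mul1r.
  have fgR : (f N).+1%:R <= (g N)%:R :> R by rewrite ler_nat.
  rewrite -natr1 in fgR.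
  apply: (sep (A%:Z + 1)); right; rewrite fE1 gE1 ler_pM2r ?invr_gt0//.
  rewrite ltr_pM2r ?invr_gt0// intrD -pmulrn.
  by apply/andP; split; lra.
- have g2lt : digit_value R b g2 / b%:R < 1.
    rewrite ltr_pdivrMr// mul1r.
    apply: (digit_value_ltb R b g2 (j - N.+1) b0 (fun n => gb _)).
    by rewrite g2j; have := fb N; lia.
  have f2ge0 : 0 <= digit_value R b f2 / b%:R by rewrite divr_ge0.
  have fgR : (g N).+1%:R <= (f N)%:R :> R by rewrite ler_nat.
  rewrite -natr1 in fgR.
  apply: (sep A%:Z); left; rewrite fE1 gE1 ler_pM2r ?invr_gt0//.
  rewrite ltr_pM2r ?invr_gt0// -pmulrn.
  by apply/andP; split; lra.
Qed.

(** * Eventually periodic words [U V V V ...] and their rational values *)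

Definition periodize {T : Type} (f : nat -> T) (r s n : nat) : T :=
  if (n < r)%N then f n else f (r + (n - r) %% s)%N.

(** The part [V V V ...] is unchanged by a shift of [s], so its value [x] satisfies
    [x = (A1 + x) / b ^ s], whence [x = A1 / (b ^ s - 1)]. *)
Lemma periodize_value (R : realType) b f r s : (1 < b)%N -> (0 < s)%N ->
  (forall n, f n < b)%N ->
  exists p : int, digit_value R b (periodize f r s) =
    p%:~R / (b ^ r * (b ^ s - 1))%N%:~R.
Proof.
move=> b1 s0 fb; have b0 : (0 < b)%N by lia.
have bR : b%:R != 0 :> R by rewrite pnatr_eq0; lia.
set g := periodize f r s.
have gb n : (g n < b)%N by rewrite /g /periodize; case: ifP.
have partial h N : exists A : nat, series (digit_term R b h) N = A%:R / b%:R ^+ N.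
  case: N => [|N]; first by exists 0%N; rewrite /series/= big_geq// mul0r.
  have [A ->] := partial_value_nat R b h N b0; exists (A * b)%N.
  by rewrite natrM exprSr invfM mulrA [_ * _ / _]mulrAC mulfK.
rewrite (digit_value_shift R b g r)//.
pose h n := g (n + r)%N; rewrite -[fun n => g _]/h; have hb n : (h n < b)%N by exact: gb.
have := digit_value_shift R b h s b0 hb.
have -> : (fun n => h (n + s)%N) = h.
  apply/funext => n; rewrite /h /g /periodize !ltnNge !leq_addl /=.
  by rewrite !addnK modnDr.
have [A0 ->] := partial g r; have [A1 ->] := partial h s.
have bs : (1 < b ^ s)%N by rewrite -(exp1n s) ltn_exp2r.
have bsR : b%:R ^+ s - 1 != 0 :> R.
  by rewrite subr_eq0 -natrX (eqr_nat R _ 1); lia.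
move=> E; exists ((A0 * (b ^ s - 1) + A1)%N : int).
have hE : digit_value R b h = A1%:R / (b%:R ^+ s - 1).
  apply: (mulIf bsR); rewrite divfK// mulrBr mulr1.
  rewrite {1}E mulrDl !divfK ?expf_neq0//; ring.
rewrite hE -!pmulrn natrD !natrM natrB ?expn_gt0 ?b0// !natrX.
by field; rewrite bsR expf_neq0.
Qed.

(** * Upper bounds for irrationality measures *)

Lemma irrationality_measure_le (R : realType) (xi : R) (E : nat) (c : R) :
  0 < c ->
  (forall p q : int, 0 < q -> xi != p%:~R / q%:~R ->
    c / q%:~R ^+ E <= `|xi - p%:~R / q%:~R|) ->
  (irrationality_measure xi <= E%:R%:E)%E.
Proof.
move=> c0 H; apply: ge_ereal_sup => _ [tau [tau0 inf] <-].
rewrite lee_fin leNgt; apply/negP => Etau; apply: inf.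
(* Fractions equal to [xi] escape [H]; being reduced, they have denominators dividing that of any
   fraction equal to [xi]. *)
have [Q0 Q0P] : exists Q0 : nat, forall p q : int, 0 < q -> coprimez p q ->
    xi = p%:~R / q%:~R -> q <= Q0%:Z.
  have [[p0 [q0 [q00 xiE]]]|no] := pselect (exists p0 q0 : int,
      0 < q0 /\ xi = p0%:~R / q0%:~R); last first.
    by exists 0%N => p q q0 _ E'; case: no; exists p, q.
  exists `|q0|%N => p q q1 pq; rewrite xiE => /eqP.
  have qR : q%:~R != 0 :> R by rewrite intr_eq0 gt_eqF.
  have qR0 : q0%:~R != 0 :> R by rewrite intr_eq0 gt_eqF.
  rewrite eqr_div// -!intrM eqr_int => /eqP E'.
  have : (q %| p * q0)%Z by rewrite -E' dvdz_mull.
  rewrite Gauss_dvdzr 1?coprimez_sym// => /dvdn_leq; lia.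
(* For [tau > E], the lower bound [H] and the approximation give [q ^ (tau - E) <= 1 / c], that is
   [q <= M]. *)
pose M := (c^-1) `^ (tau - E%:R)^-1.
have [Q QP] : exists Q : nat, forall pq, approximations xi tau pq -> pq.2 <= Q%:Z.
  exists (Q0 + (Num.trunc M).+1)%N => -[p q] /= [q0 [pq lt]].
  rewrite PoszD; have [xiE|ne] := eqVneq xi (p%:~R / q%:~R).
    by rewrite (le_trans (Q0P p q _ _ _))// lerDl.
  have {H}lt' := le_lt_trans (H p q q0 ne) lt.
  have qR : 0 < q%:~R :> R by rewrite ltr0z.
  suff : q%:~R <= (Num.trunc M).+1%:R :> R.
    by rewrite pmulrn ler_int; move=> h; rewrite (le_trans h)// lerDr.
  apply: le_trans (ltW (truncnS_gt M)).
  have tE : 0 < tau - E%:R by rewrite subr_gt0.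
  have : q%:~R `^ (tau - E%:R) <= c^-1.
    rewrite powRB ?gt_eqF ?implybT// powR_mulrn ?(ltW qR)//.
    rewrite powRN in lt'.
    move: lt'; have := powR_gt0 tau qR; have : 0 < q%:~R ^+ E :> R.
      by rewrite exprn_gt0.
    move: (q%:~R `^ tau) (q%:~R ^+ E) => x y y0 x0.
    rewrite ltr_pdivrMr// [_^-1 * _]mulrC ltr_pdivlMr// => h.
    by rewrite ler_pdivrMr// [_ * y]mulrC ler_pdivlMr// mulrC ltW.
  move=> h.
  have := ge0_ler_powR (ltW (_ : 0 < (tau - E%:R)^-1)) _ _ h.
  rewrite invr_gt0 tE -powRrM divff ?gt_eqF// powRr1 ?(ltW qR)//.
  by apply; rewrite ?nnegrE ?powR_ge0 ?invr_ge0 ?ltW.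
(* As [q ^ (- tau) <= 1], numerators are at most [q (|xi| + 1)] in absolute value; bounded
   denominators then leave finitely many fractions. *)
pose P := (Num.trunc (Q%:R * (`|xi| + 1))).+1.
apply: (@sub_finite_set _ _
  ((fun ij : nat * nat => (ij.1%:Z - P%:Z, ij.2%:Z)) @`
    (`I_((P + P).+1) `*` `I_(Q.+1)))); last first.
  by apply: finite_image; apply: finite_setX; exact: finite_II.
move=> [p q] apq; have /= qQ := QP _ apq; case: apq => /= q0 [_ lt].
have qR : 0 < q%:~R :> R by rewrite ltr0z.
have q1 : 1 <= q%:~R :> R by rewrite -[1]/(1%:~R) ler_int -gtz0_ge1.
have lt1 : `|xi - p%:~R / q%:~R| < 1.
  have : q%:~R `^ (- tau) <= q%:~R `^ 0 by apply: ler_powR => //; lra.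
  by rewrite powRr0; exact: lt_le_trans.
have pP : `|p| <= P%:Z.
  rewrite -(ler_int R) -pmulrn ltW// (le_lt_trans _ (truncnS_gt _))//.
  rewrite intr_norm.
  have -> : p%:~R = (xi - (xi - p%:~R / q%:~R)) * q%:~R :> R.
    by rewrite opprB addrC subrK divfK ?gt_eqF.
  rewrite normrM (gtr0_norm qR) mulrC ler_pM//; first exact: ltW.
    by rewrite pmulrn ler_int.
  by apply: (le_trans (ler_normB _ _)); rewrite lerD2l ltW.
rewrite ler_norml in pP; exists (absz (p + P%:Z), absz q) => /=; last by congr pair; lia.
by split => /=; lia.
Qed.

(** Distinct fractions are at least [1 / (q q')] apart, so exponent 1 already works with
    [c = 1 / q]. *)
Lemma irrationality_measure_rat (R : realType) (p q : int) (E : nat) :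
  0 < q -> (0 < E)%N ->
  (irrationality_measure (p%:~R / q%:~R : R) <= E%:R%:E)%E.
Proof.
move=> q0 E0; have qR : 0 < q%:~R :> R by rewrite ltr0z.
apply: (@irrationality_measure_le R _ E q%:~R^-1); first by rewrite invr_gt0.
move=> p' q' q'0 ne; apply: le_trans (fraction_dist_ge R _ _ _ _ q0 q'0 ne).
have q'R : 1 <= q'%:~R :> R by rewrite -[1]/(1%:~R) ler_int -gtz0_ge1.
have q'R0 : 0 < q'%:~R :> R by rewrite ltr0z.
rewrite [leRHS]invfM ler_pM2l ?invr_gt0// lef_pV2 ?posrE ?exprn_gt0//.
by rewrite ler_eXnr.
Qed.

(* Given [p / q], compare it with the first [P n / Q n] that is closer to [xi]
   than [1 / (2 q Q n)]: either the two fractions differ, hence are at least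
   [1 / (q Q n)] apart, or the assumed lower bound for [P n / Q n] applies. *)
Lemma irrationality_measure_le_dense (R : realType) (xi : R) (b k t rho : nat)
    (P : nat -> int) (Q : nat -> nat) :
  (1 < b)%N -> (1 < k)%N -> (0 < t)%N -> (0 < rho)%N ->
  (forall n, 0 < Q n <= b ^ (t * k ^ n))%N ->
  (forall n, `|xi - (P n)%:~R / (Q n)%:R| <= b%:R / b%:R ^+ (t * k ^ n + k ^ n)) ->
  (forall n, (b%:R ^+ (t * k ^ n * (rho + 1)))^-1 <=
    `|xi - (P n)%:~R / (Q n)%:R|) ->
  (irrationality_measure xi <= (t * k * (rho + 1))%N%:R%:E)%E.
Proof.
move=> b1 k1 t0 rho0 QP ub lb; set B := (t * k * (rho + 1))%N.
have b2R : 0 < (b%:R ^+ 2) ^+ B :> R by rewrite !exprn_gt0// ltr0n; lia.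
apply: (@irrationality_measure_le R xi B ((b%:R ^+ 2) ^+ B)^-1).
  by rewrite invr_gt0.
move=> p q q0 ne; pose w := `|q|%N; have qw : q%:~R = w%:R :> R.
  by rewrite pmulrn gtz0_abs.
have w0 : (0 < w)%N by rewrite absz_gt0 gt_eqF.
(* One factor [b] absorbs the numerator [b] in [ub], the other the 2 in [1 / (2 q Q n)]. The
   constant was chosen to make the target [W ^ (- B)]. *)
pose W := (b ^ 2 * w)%N.
have bpow0 e : (0 < b ^ e)%N by rewrite expn_gt0; lia.
have W0 : (0 < W)%N by rewrite muln_gt0 bpow0.
have -> : ((b%:R ^+ 2) ^+ B)^-1 / q%:~R ^+ B = (W ^ B)%N%:R^-1 :> R.
  by rewrite qw -invfM -exprMn -natrX -natrM -natrX.
have bX e : 0 < (b ^ e)%N%:R :> R by rewrite ltr0n bpow0.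
have WX e : 0 < (W ^ e)%N%:R :> R by rewrite ltr0n expn_gt0 W0.
have exn : exists n, (W <= b ^ (k ^ n))%N.
  exists (2 + w)%N; apply: (@leq_trans (b ^ (2 + w))).
    by rewrite expnD leq_mul2l ltnW ?orbT// ltn_expl.
  by rewrite leq_exp2l// ltnW// ltn_expl.
case: (ex_minnP exn) => n Wn nmin.
(* [W >= b ^ 2 > b ^ (k ^ 0)], so [n] has a predecessor, to which minimality applies. *)
have n0 : (0 < n)%N.
  rewrite lt0n; apply: contraTneq Wn => ->; rewrite expn0 expn1 -ltnNge /W.
  by rewrite expnS expn1 -mulnA; nia.
have bW : (b ^ (k ^ n.-1) <= W)%N.
  by rewrite leqNgt; apply/negP => /ltnW /nmin; lia.
(* Passing from [n - 1] to [n] is the origin of the factor [k] in the final bound. *)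
have bW' : (b ^ (t * k ^ n) <= W ^ (t * k))%N.
  have -> : (t * k ^ n = k ^ n.-1 * (t * k))%N.
    by rewrite -{1}(prednK n0) expnS; lia.
  by rewrite expnM leq_exp2r// muln_gt0 t0; lia.
have [Qn0 Qnb] := andP (QP n).
have QR : 0 < (Q n)%:R :> R by rewrite ltr0n.
have wR : 0 < w%:R :> R by rewrite ltr0n.
have [eq|neq] := eqVneq (p%:~R / q%:~R : R) ((P n)%:~R / (Q n)%:R).
  rewrite eq (le_trans _ (lb n))//.
  rewrite -natrX lef_pV2 ?posrE ?bX ?WX// ler_nat.
  rewrite expnM /B [(W ^ _)%N]expnM leq_exp2r//; lia.
have dist : (w%:R * (Q n)%:R)^-1 <= `|p%:~R / q%:~R - (P n)%:~R / (Q n)%:R| :> R.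
  have := fraction_dist_ge R p q (P n) (Q n)%:Z q0; rewrite qw -pmulrn.
  by apply; rewrite ?ltz_nat// -qw.
set Y := (b ^ (t * k ^ n))%N in bW' Qnb.
have YR : 0 < Y%:R :> R by exact: bX.
have dist' : (w%:R * Y%:R)^-1 <= `|p%:~R / q%:~R - (P n)%:~R / (Q n)%:R| :> R.
  apply: le_trans dist; rewrite lef_pV2 ?posrE ?mulr_gt0// ler_pM2l//.
  by rewrite ler_nat.
have close : `|xi - (P n)%:~R / (Q n)%:R| <= (w%:R * Y%:R)^-1 / 2.
  apply: le_trans (ub n) _; rewrite -natrX expnD -/Y natrM.
  rewrite -invfM ler_pdivrMr ?mulr_gt0 ?bX// [leRHS]mulrC.
  rewrite ler_pdivlMr ?mulr_gt0// -!natrM ler_nat.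
  apply: (@leq_trans (Y * W)%N); last by rewrite leq_mul2l Wn orbT.
  rewrite /W expnS expn1; have : (b * 2 <= b * b)%N by rewrite leq_mul2l b1 orbT.
  by nia.
have half : (w%:R * Y%:R)^-1 / 2 <= `|xi - p%:~R / q%:~R|.
  have := ler_distD xi (p%:~R / q%:~R) ((P n)%:~R / (Q n)%:R).
  rewrite (distrC _ xi); lra.
apply: le_trans half; rewrite -invfM lef_pV2 ?posrE ?mulr_gt0 ?WX//.
rewrite -!natrM ler_nat; apply: (@leq_trans (W ^ (t * k) * W)%N).
  have -> : (w * Y * 2 = Y * (w * 2))%N by lia.
  by apply: leq_mul => //; rewrite /W expnS expn1; nia.
rewrite -expnSr leq_exp2l; [|rewrite /W expnS expn1; nia].
(* [t k + 1 <= B] because [rho] is positive. *)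
by rewrite /B; have : (0 < t * k)%N; nia.
Qed.

(** * Periodic approximations of an automatic sequence *)

Lemma periodize_prefix (T : Type) (f : nat -> T) r s n : (n < r + s)%N ->
  periodize f r s n = f n.
Proof.
move=> nrs; rewrite /periodize; case: (ltnP n r) => // rn.
by rewrite modn_small ?subnKC//; lia.
Qed.

Lemma repeated_letter (I : finType) (u : nat -> I) :
  exists r t, [/\ (r < t)%N, (t <= #|I|)%N & u r = u t].
Proof.
have /injectivePn[x [y ne eq]] : ~~ injectiveb (fun x : 'I_#|I|.+1 => u x).
  apply/negP => /injectiveP /leq_card.
  by rewrite card_ord ltnn.
have := ltn_ord x; have := ltn_ord y.
case: (ltngtP x y) => [xy|yx|/val_inj xy]; last by rewrite xy eqxx in ne.
  by exists x, y.
by exists y, x.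
Qed.

Theorem theorem2 (R : realType) (k b : nat) (hk : (2 <= k)%N) (hb : (2 <= b)%N)
    (a : nat -> 'I_b) (ha : automatic k a)
    (I : finType) (sigma : I -> seq I) (i : I) (phi : I -> 'I_b)
    (hsigma : uniform_morph k sigma)
    (hi : ohead (sigma i) = Some i)
    (hrepr : forall n, a n = phi (morph_limit sigma i n))
    (d m : nat) (hd : d = #|I|)
    (hm : m = #|` fset_set (k_kernel k a)|%fset)
    (xi : R)
    (hxi : xi = limn (series (fun n : nat => (a n)%:R / b%:R ^+ n : R))) :
  (irrationality_measure xi <= ((d * k * (k ^ m + 1))%N%:R)%:E)%E.
Proof.
have k0 : (0 < k)%N by lia.
have b0 : (0 < b)%N by lia.
pose f n : nat := a n; have fb n : (f n < b)%N by exact: ltn_ord.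
have -> : xi = digit_value R b f by rewrite hxi.
have fin := finite_k_kernel k _ a I sigma i phi hk hsigma hi hrepr.
have [r0 [t [rt td urt]]] := repeated_letter I (morph_limit sigma i).
have t0 : (0 < t)%N by lia.
pose r n := (r0 * k ^ n)%N; pose s n := ((t - r0) * k ^ n)%N.
pose g n := periodize f (r n) (s n).
have kn0 n : (0 < k ^ n)%N by rewrite expn_gt0 k0.
have s0 n : (0 < s n)%N by rewrite muln_gt0 subn_gt0 rt kn0.
have rs n : (r n + s n = t * k ^ n)%N by rewrite -mulnDl subnKC// ltnW.
have gb n N : (g n N < b)%N by rewrite /g /periodize; case: ifP.
have [p pE] := choice (fun n => periodize_value R b f (r n) (s n) hb (s0 n) fb).
(* The bound is proved with [t] in place of [d], which is stronger as [t <= d]. *)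
apply: (@le_trans _ _ ((t * k * (k ^ m + 1))%N%:R)%:E); last first.
  by rewrite lee_fin ler_nat !leq_mul2r hd td !orbT.
pose Q n := (b ^ r n * (b ^ s n - 1))%N.
have Q0 n : (0 < Q n)%N.
  by rewrite muln_gt0 expn_gt0 b0 subn_gt0 -(exp1n (s n)) ltn_exp2r.
have QR n : 0 < (Q n)%:~R :> R by rewrite -pmulrn ltr0n.
have [[n gf]|aper] := pselect (exists n, g n = f).
  rewrite -gf pE; apply: irrationality_measure_rat; first by rewrite ltz_nat Q0.
  by rewrite !muln_gt0 t0 k0 addn1.
(* Past [t k ^ n], the index [t k ^ n + j] with [j < k ^ n <= s n] is compared with [r0 k ^ n + j]:
   both letters are images under the same [h] of equal letters. *)
have agree n N : (N < t * k ^ n + k ^ n)%N -> f N = g n N.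
  move=> Nb; have [|rsN] := ltnP N (r n + s n).
    by move=> ?; rewrite /g periodize_prefix.
  have [j [jk NE]] : exists j, (j < k ^ n)%N /\ N = (k ^ n * t + j)%N.
    by exists (N - t * k ^ n)%N; rewrite rs in rsN; split; lia.
  have [h hE] := morph_limit_pow _ _ _ i n j hk hsigma hi jk.
  rewrite /g /periodize ltnNge (leq_trans (leq_addr _ _) rsN) /=.
  have -> : ((N - r n) %% s n = j)%N.
    have -> : (N - r n = j + s n)%N by have := rs n; lia.
    rewrite modnDr modn_small// (leq_trans jk)// leq_pmull// subn_gt0//.
  by rewrite /f !hrepr NE hE -urt -hE mulnC.
apply: (@irrationality_measure_le_dense R _ b k t (k ^ m) p Q) => //.
- move=> n; rewrite Q0 /= -rs expnD leq_mul2l; lia.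
- by move=> n; rewrite pmulrn -pE; exact: digit_value_dist_le (agree n).
- move=> n; rewrite [(Q n)%:R]pmulrn -pE.
  have exN : exists N, f N != g n N.
    apply/not_existsP => H; apply: aper; exists n; apply/funext => N.
    by apply/esym/eqP/negPn/negP/H.
  case: (ex_minnP exN) => N fgN Nmin.
  have rN : (r n <= N)%N.
    rewrite leqNgt; apply: contra fgN => Nr.
    by rewrite /g periodize_prefix// ltn_addr.
  (* Agreement up to [k ^ m (r n + s n)] would make [a] periodic from [r n] on, so [f] and [g n]
     could not differ at [N]. *)
  have NL : (N < k ^ m * (r n + s n))%N.
    rewrite ltnNge; apply/negP => LN; move/negP: fgN; apply; apply/eqP.
    rewrite /g /periodize ltnNge rN /= /f; congr nat_of_ord.
    apply: (@periodic_of_periodic_prefix k _ a (r n) (s n)) => //.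
    move=> N'; rewrite -hm => /andP[rN' N'L]; apply: val_inj => /=.
    have /negPn/eqP : ~~ (f N' != g n N').
      by apply/negP => /Nmin; rewrite leqNgt (leq_trans N'L LN).
    by rewrite /g /periodize ltnNge rN'.
  (* As [N >= r n], the digit [g n N] recurs one period later. The bound on [N] gives the exponent
     [N + t k ^ n <= (k ^ m + 1) t k ^ n]. *)
  apply: le_trans (digit_value_dist_ge R b f (g n) N (N + s n) (p n) (Q n)
    b0 fb (gb n) _ fgN _ _ _ (pE n)).
  - have bR : 1 <= b%:R :> R by rewrite ler1n.
    rewrite -pmulrn -natrX -natrX -natrM lef_pV2 ?posrE ?ltr0n ?expn_gt0 ?b0//.
      rewrite ler_nat; apply: (@leq_trans (b ^ N * b ^ (r n + s n))).
        by rewrite leq_mul2l expnD leq_mul2l; lia.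
      rewrite -expnD leq_exp2l// rs; rewrite rs in NL; nia.
    by rewrite muln_gt0 expn_gt0 b0 Q0.
  - move=> N' N'N; apply/eqP/negPn/negP => /Nmin; lia.
  - by have := s0 n; lia.
  - rewrite /g /periodize !ltnNge rN (leq_trans rN (leq_addr _ _)) /=.
    by rewrite -addnBAC// modnDr.
  - by rewrite ltz_nat Q0.
Qed.
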